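(* Let $q$ be a prime power, $m\ge 1$, and let $C$ be an $[n,k]$ cyclic code over $\mathbb{F}_{q^m}$ with $1\le k\le n-1$, where $n$ and $q$ are coprime. Then $C$ has rank weight $1$ if and only if $\eta_q(C)\le n-1$.
   Context: An $[n,k]$ linear code over $\mathbb{F}_{q^m}$ is a $k$-dimensional $\mathbb{F}_{q^m}$-subspace $C$ of $\mathbb{F}_{q^m}^n$. It is cyclic with generator polynomial $g(x)$ (monic, dividing $x^n-1$, of degree $n-k$) if, identifying vectors with polynomials of degree $\le n-1$, $C$ is the ideal generated by $g(x)$ in $\mathbb{F}_{q^m}[x]/(x^n-1)$, i.e. $C=\{c(x)g(x) : c(x)\in\mathbb{F}_{q^m}[x],\ \deg c\le k-1\}$. The rank weight of a vector $c=(c_1,\dots,c_n)\in\mathbb{F}_{q^m}^n$ is the rank over $\mathbb{F}_q$ of the $m\times n$ matrix $\lambda(c)$ whose $i$-th column is the coordinate vector of $c_i$ in a fixed $\mathbb{F}_q$-basis of $\mathbb{F}_{q^m}$. The rank weight of a code $C$ is $d_1(\lambda(C))=\min_{c\in C,\,c\ne 0}\mathrm{rk}(\lambda(c))$. Definition of $\eta_q(C)$ ($n$ coprime to $q$): let $m'$ be a multiple of $m$ such that $g(x)$ splits in $\mathbb{F}_{q^{m'}}[x]$; its roots are simple. Partition the roots of $g(x)$ into classes, two roots being in the same class if and only if they have the same minimal polynomial over $\mathbb{F}_q$, and choose one representative $\beta_1,\dots,\beta_s$ in each class. Then $\eta_q(C)=\sum_{j=1}^{s}[\mathbb{F}_q(\beta_j):\mathbb{F}_q]$.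 *)

(* Defs.v *)
From HB Require Import structures.
From mathcomp Require Import all_boot all_order all_fingroup all_algebra.
From mathcomp Require Import all_solvable all_field.

Set Implicit Arguments.
Unset Strict Implicit.
Unset Printing Implicit Defensive.

Import GRing.Theory.
Local Open Scope ring_scope.

Section RankWeight.

Variables (F : finFieldType) (L : fieldExtType F) (m n : nat).
Variable e : m.-tuple L.

Definition lambda (c : 'rV[L]_n) : 'M[F]_(m, n) :=
  \matrix_(i, j) coord e i (c 0 j).

Definition rank_weight (c : 'rV[L]_n) : nat := \rank (lambda c).

(* A relation rather than a function: the zero code has no rank weight. *)
Definition has_rank_weight (C : {vspace 'rV[L]_n}) (w : nat) : Prop :=
  (exists c, [/\ c \in C, c != 0 & rank_weight c = w]) /\
  (forall c, c \in C -> c != 0 -> (w <= rank_weight c)%N).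

End RankWeight.

Section Cyclic.

Variables (K : fieldType) (n : nat).

(* C is the ideal generated by g in K[X]/(X^n - 1), a vector c being         *)
(* identified with rVpoly c = c_0 + c_1 X + ... + c_(n-1) X^(n-1).           *)
Definition cyclic_code (C : {vspace 'rV[K]_n}) (k : nat) (g : {poly K}) :
    Prop :=
  [/\ \dim C = k,
      g \is monic,
      g %| 'X^n - 1,
      size g = (n - k).+1
    & forall c : 'rV[K]_n,
        c \in C <->
        exists a : {poly K}, (size a <= k)%N /\ rVpoly c = a * g].

End Cyclic.

Definition splits (K : fieldType) (p : {poly K}) : Prop :=
  exists s : seq K, p %= \prod_(z <- s) ('X - z%:P).

Section Eta.

Variables (F : finFieldType) (E : fieldExtType F).

(* minPoly 1 z is the minimal polynomial of z over the base field F, seen in *)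
(* E[X]; the list bs contains exactly one root of p for each class of roots  *)
(* having the same minimal polynomial.                                       *)
Definition class_representatives (p : {poly E}) (bs : seq E) : Prop :=
  [/\ forall b, b \in bs -> root p b,
      uniq [seq minPoly 1 b | b <- bs]
    & forall z, root p z -> exists2 b, b \in bs & minPoly 1 b = minPoly 1 z].

(* eta_q(C), from representatives bs of the classes of roots of the          *)
(* generator polynomial; \dim is the dimension over F, so each term is       *)
(* the degree [F(b) : F].                                                    *)
Definition eta_q (bs : seq E) : nat := (\sum_(b <- bs) \dim <<1; b>>)%N.

End Eta.

(* Main.v *)
Require Import Defs.
From HB Require Import structures.
From mathcomp Require Import all_boot all_order all_fingroup all_algebra.
From mathcomp Require Import all_solvable all_field.

Set Implicit Arguments.
Unset Strict Implicit.
Unset Printing Implicit Defensive.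

Import GRing.Theory.
Local Open Scope ring_scope.

(* A nonzero word has rank weight 1 exactly when it is a scalar multiple of a
   word over F, so C has rank weight 1 iff g divides some nonzero f in F[X] of
   degree < n.  As g has simple roots, the least such f is the product of the
   minimal polynomials over F of the classes of roots of g, of degree eta. *)

(** Lagrange in the additive group of [F] gives [#|F|%:R = 0]; if also [n%:R = 0], a Bezout relation
    between [#|F|] and [n] would read [0 = 1] in [F]. *)
Lemma natf_coprime_card_neq0 (F : finFieldType) (n : nat) :
  coprime n #|F| -> n%:R != 0 :> F.
Proof.
move=> co_nF; apply/eqP=> n0.
have F0 : #|F|%:R = 0 :> F.
  by rewrite -cardsT -FinRing.zmodXgE expg_cardG ?in_setT.
have [|u v uvE _] := @egcdnP #|F| n; first exact: ltnW (finNzRing_gt1 F).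
move: (congr1 (fun i => i%:R : F) uvE).
rewrite natrD !natrM F0 n0 !mulr0 add0r gcdnC (eqP co_nF) => /eqP.
by rewrite eq_sym oner_eq0.
Qed.

Section MinPoly.

Variables (F : fieldType) (E : fieldExtType F) (K : {subfield E}).

(** The gcd has coefficients in [K] and divides an irreducible, so it is constant or associated to
    [minPoly K x]. In the latter case one monic irreducible divides the other, hence they are
    equal. *)
Lemma coprimep_minPoly (x y : E) :
  minPoly K x != minPoly K y -> coprimep (minPoly K x) (minPoly K y).
Proof.
have ndvd z t : minPoly K z != minPoly K t -> ~~ (minPoly K z %| minPoly K t).
  apply: contra => /(minPoly_irr (minPolyOver K z)) /orP [].
    by rewrite eqp_monic ?monic_minPoly.
  by rewrite -size_poly_eq1 size_minPoly.
move=> neq_xy; rewrite /coprimep size_poly_eq1.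
have d_over := gcdp_polyOver (minPolyOver K x) (minPolyOver K y).
have /orP [/eqp_dvdl dE|//] := minPoly_irr d_over (dvdp_gcdl _ _).
by move: (ndvd _ _ neq_xy); rewrite -dE dvdp_gcdr.
Qed.

Lemma prod_minPoly_dvdp (bs : seq E) (p : {poly E}) :
  p \is a polyOver K -> uniq [seq minPoly K b | b <- bs] ->
  (forall b, b \in bs -> root p b) -> \prod_(b <- bs) minPoly K b %| p.
Proof.
move=> pK; elim: bs => [|b bs IHbs] /=; first by rewrite big_nil dvd1p.
case/andP=> b_notin uniq_bs rootp; rewrite big_cons Gauss_dvdp; last first.
  rewrite big_seq; elim/big_ind: _ => [|s t cps cpt|c c_bs].
  - exact: coprimep1.
  - by rewrite coprimepMr cps.
  by apply: coprimep_minPoly; apply: contraNneq b_notin => ->; apply: map_f.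
rewrite minPoly_dvdp ?rootp ?mem_head ?IHbs // => c c_bs.
by rewrite rootp // inE c_bs orbT.
Qed.

Lemma size_prod_minPoly (bs : seq E) :
  size (\prod_(b <- bs) minPoly K b) = (\sum_(b <- bs) adjoin_degree K b).+1.
Proof.
elim: bs => [|b bs IHbs]; first by rewrite !big_nil size_poly1.
rewrite !big_cons size_monicM ?monic_minPoly ?monic_neq0 ?monic_prod //.
  by rewrite IHbs size_minPoly addnS.
by move=> i _; apply: monic_minPoly.
Qed.

End MinPoly.

Lemma separable_splits_dvdp (K : fieldType) (g p : {poly K}) :
  splits g -> separable_poly g -> (forall z, root g z -> root p z) -> g %| p.
Proof.
case=> s g_s sep_g rootp; rewrite (eqp_dvdl _ g_s); apply: uniq_roots_dvdp.
  apply/allP=> z z_s; apply: rootp.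
  by rewrite (eqp_root g_s) root_prod_XsubC.
by rewrite uniq_rootsE -separable_prod_XsubC -(eqp_separable g_s).
Qed.

(** The bound on the cofactor is automatic: [rVpoly c] has size at most [n] and [g] is monic of
    degree [n - k]. *)
Lemma cyclic_code_memE (K : fieldType) (n k : nat) (C : {vspace 'rV[K]_n})
    (g : {poly K}) (c : 'rV[K]_n) :
  (k <= n)%N -> cyclic_code C k g -> (c \in C) = (g %| rVpoly c).
Proof.
move=> le_kn [_ g_mon _ size_g memC]; apply/idP/idP=> [/memC[a [_ ->]]|].
  exact: dvdp_mull.
case/dvdpP=> a c_ag; apply/memC; exists a; split=> //.
have [->|a0] := eqVneq a 0; first by rewrite size_poly0.
have : (size (rVpoly c) <= n)%N by apply: size_poly.
rewrite c_ag mulrC size_monicM // size_g addSn /=.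
by rewrite -{2}(subnK le_kn) leq_add2l.
Qed.

Section RankOne.

Variables (F : finFieldType) (L : fieldExtType F) (m n : nat).
Variables (e : m.-tuple L) (he : basis_of {:L} e).

Lemma rank_weight_gt0 (c : 'rV[L]_n) : c != 0 -> (0 < rank_weight e c)%N.
Proof.
apply: contraNT; rewrite lt0n negbK mxrank_eq0 => /eqP lam0.
apply/eqP/rowP=> j; rewrite mxE (coord_basis he (memvf (c 0 j))).
apply: big1 => i _; move/matrixP/(_ i j): lam0; rewrite !mxE => ->.
exact: scale0r.
Qed.

Lemma rank_weight_map_in_alg (v : 'rV[F]_n) :
  (rank_weight e (map_mx (in_alg L) v) <= 1)%N.
Proof.
rewrite /rank_weight.
(* Each entry of the word is an [F]-multiple of 1, so the matrix is a column times a row. *)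
suff -> : lambda e (map_mx (in_alg L) v) = (\col_i coord e i 1) *m v.
  exact: leq_trans (mxrankM_maxr _ _) (rank_leq_row _).
apply/matrixP=> i j; rewrite !mxE big_ord1 !mxE /=.
by rewrite linearZ /= mulrC.
Qed.

(** In a rank 1 matrix every row is a multiple of one nonzero row [v]. Reading the column of
    multipliers as coordinates in the basis [e] gives the scalar [a]. *)
Lemma rank_weight1_map_in_alg (c : 'rV[L]_n) : rank_weight e c = 1%N ->
  exists a (v : 'rV[F]_n), c = a *: map_mx (in_alg L) v.
Proof.
move=> rk1; have [i0 row_neq0] : exists i, row i (lambda e c) != 0.
  apply/existsP; rewrite -negb_forall; apply/negP=> /forallP rows0.
  suff lam0 : lambda e c = 0 by move: rk1; rewrite /rank_weight lam0 mxrank0.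
  by apply/row_matrixP=> i; rewrite (eqP (rows0 i)) row0.
have sub := row_sub i0 (lambda e c).
(* A nonzero row already has rank 1, so it spans the whole row space. *)
have : (lambda e c <= row i0 (lambda e c))%MS.
  rewrite -(mxrank_leqif_sup sub) [\rank (lambda e c)]rk1.
  by rewrite eqn_leq rank_leq_row lt0n mxrank_eq0.
case/submxP=> D lamE; exists (\sum_i D i 0 *: e`_i), (row i0 (lambda e c)).
apply/rowP=> j; rewrite [LHS](coord_basis he (memvf (c 0 j))) !mxE /=.
rewrite mulr_suml; apply: eq_bigr => i _.
move/matrixP/(_ i j): lamE; rewrite [LHS]mxE => ->.
by rewrite !mxE big_ord1 !mxE -scalerAl -scalerAr mulr1 scalerA.
Qed.

Lemma has_rank_weight1P (C : {vspace 'rV[L]_n}) :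
  has_rank_weight e C 1 <->
  exists2 v : 'rV[F]_n, v != 0 & map_mx (in_alg L) v \in C.
Proof.
split=> [[[c [cC c0 /rank_weight1_map_in_alg[a [v cE]]]] _]|[v v0 vC]].
  exists v; first by apply: contraNneq c0 => v0; rewrite cE v0 map_mx0 scaler0.
  have a0 : a != 0 by apply: contraNneq c0 => a0; rewrite cE a0 scale0r.
  by rewrite -[map_mx _ v]scale1r -(mulVf a0) -scalerA -cE memvZ.
split=> [|c _ c0]; last exact: rank_weight_gt0.
have av0 : map_mx (in_alg L) v != 0 by rewrite map_mx_eq0.
exists (map_mx (in_alg L) v); split=> //.
by apply/eqP; rewrite eqn_leq rank_weight_map_in_alg rank_weight_gt0.
Qed.

End RankOne.

Lemma cyclic_rank_weight1P (F : finFieldType) (L : fieldExtType F) (m n k : nat)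
    (e : m.-tuple L) (C : {vspace 'rV[L]_n}) (g : {poly L}) :
  basis_of {:L} e -> (k <= n)%N -> cyclic_code C k g ->
  has_rank_weight e C 1 <->
  exists f : {poly F},
    [/\ f != 0, (size f <= n)%N & g %| map_poly (in_alg L) f].
Proof.
move=> he le_kn hC; apply: (iff_trans (has_rank_weight1P he C)).
split=> [[v v0 vC]|[f [f0 size_f g_f]]].
  exists (rVpoly v); split; last 1 first.
  - by rewrite map_rVpoly -(cyclic_code_memE _ le_kn hC).
  - by apply: contraNneq v0 => v0; rewrite -[v]rVpolyK v0 linear0.
  exact: size_poly.
exists (poly_rV f); last first.
  by rewrite (cyclic_code_memE _ le_kn hC) -map_rVpoly poly_rV_K.
by apply: contraNneq f0 => f0; rewrite -(poly_rV_K size_f) f0 linear0.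
Qed.

Theorem proposition3 (q m n k : nat)
  (F : finFieldType) (hq : #|F| = q)
  (L : fieldExtType F) (hm : \dim {:L} = m)
  (e : m.-tuple L) (he : basis_of {:L} e)
  (C : {vspace 'rV[L]_n}) (g : {poly L}) (hC : cyclic_code C k g)
  (hk : (1 <= k <= n - 1)%N) (hnq : coprime n q)
  (E : fieldExtType F) (iota : {lrmorphism L -> E})
  (hE : splits (map_poly iota g))
  (bs : seq E) (hbs : class_representatives (map_poly iota g) bs) :
  has_rank_weight e C 1 <-> (eta_q bs <= n - 1)%N.
Proof.
have le_kn : (k <= n)%N by case/andP: hk => _ /leq_trans-> //; apply: leq_subr.
have n_gt0 : (0 < n)%N by case/andP: hk => /leq_trans/(_ le_kn).
apply: (iff_trans (cyclic_rank_weight1P he le_kn hC)).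
have [root_bs uniq_bs repr_bs] := hbs.
(* Divisibility is invariant under field extension, and [iota] is [F]-linear, so it fixes the
   coefficients of [f]; the roots of [g] in [E] can thus be used. *)
have g_fE (f : {poly F}) : 
    (g %| map_poly (in_alg L) f) = (map_poly iota g %| map_poly (in_alg E) f).
  rewrite -(dvdp_map iota) -map_poly_comp.
  by congr (_ %| _); apply: eq_map_poly => a /=; rewrite rmorph_alg.
have size_M : size (\prod_(b <- bs) minPoly 1 b) = (eta_q bs).+1.
  rewrite size_prod_minPoly; congr _.+1; apply: eq_bigr => b _.
  by rewrite dim_Fadjoin dimv1 muln1.
(* As size is degree plus one and [n] is positive, [eta_q bs <= n - 1] says that the product of
   minimal polynomials has size at most [n]. *)
rewrite -ltnS subn1 prednK // -size_M; split=> [[f [f0 size_f]]|size_leq].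
  rewrite g_fE => g_f.
  have f_bs : \prod_(b <- bs) minPoly 1 b %| map_poly (in_alg E) f.
    apply: prod_minPoly_dvdp uniq_bs _ => [|b /root_bs].
      by apply/polyOver1P; exists f.
    exact: root_dvdp.
  apply: leq_trans (dvdp_leq _ f_bs) _; first by rewrite map_poly_eq0.
  by rewrite size_map_poly.
(* Conversely, the product itself descends to [F] and serves as [f]. *)
have /polyOver1P[f fE] : \prod_(b <- bs) minPoly 1 b \is a polyOver 1%VS.
  by apply: rpred_prod => b _; apply: minPolyOver.
exists f; split.
- by rewrite -(map_poly_eq0 (in_alg E)) -fE -size_poly_gt0 size_M.
- by rewrite -(size_map_poly (in_alg E)) -fE.
(* The roots of [g] are simple since [g] divides ['X^n - 1], separable because [n] is nonzero in
   [L]. It remains that each root of [g] is a root of the minimal polynomial of its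
   representative. *)
rewrite g_fE -fE; apply: separable_splits_dvdp hE _ _.
  have [_ _ g_dvd _ _] := hC; rewrite separable_map.
  apply: dvdp_separable g_dvd _; apply: separable_Xn_sub_1.
  by rewrite -(rmorph_nat (in_alg L)) fmorph_eq0 natf_coprime_card_neq0 ?hq.
move=> z /repr_bs[b b_bs bz]; rewrite (big_rem b) //= rootM bz.
by rewrite root_minPoly.
Qed.
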